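(* Let $G=(V,E)$ be a finite simple graph and let $\beta(\lambda)$ be its pseudo-characteristic function. Then $\beta$ is the geometric mean of the characteristic polynomials of all signed graphs with underlying graph $G$, i.e. $$\beta(\lambda)=\prod_{\pi\in\Pi}\phi_\pi(\lambda)^{2^{-|E|}}.$$ Moreover, $\beta(\lambda)$ equals the characteristic polynomial of the adjacency matrix of $G$ if and only if $G$ is a forest.
   Context: $\Pi$ is the set of all sign functions $\pi:E\to\{\pm1\}$; $G_\pi$ is the signed graph with signed adjacency matrix having $(u,v)$ entry $\pi(\{u,v\})$ if $\{u,v\}\in E$ and $0$ otherwise, and $\phi_\pi(\lambda)$ is the characteristic polynomial of this matrix. A signed subgraph of $G$ is a subgraph of $G$ (not necessarily induced or spanning) with a sign function on its edges. Let $\sigma_1^2,\ldots,\sigma_\varsigma^2$ be the distinct elements of the set of squares of nonzero eigenvalues of all signed subgraphs of $G$, and let $\mathrm{M}$ be the $\varsigma\times\varsigma$ matrix with $\mathrm{M}_{\ell i}=\sigma_i^{2\ell}$. Let $\widehat G_1,\ldots,\widehat G_\chi$ be representatives of the isomorphism classes of connected subgraphs of $G$ with at most $\varsigma$ edges; let $\mathrm{P}$ be the $\varsigma\times\chi$ matrix with $\mathrm{P}_{\ell i}$ the number of closed walks of length $2\ell$ in $\widehat G_i$ that use every edge of $\widehat G_i$ a positive even number of times; let $N=(N_G(\widehat G_1),\ldots,N_G(\widehat G_\chi))^\top$ where $N_G(\widehat G)$ is the number of subgraphs of $G$ isomorphic to $\widehat G$. Set $\mu_i(2)=\frac12(\mathrm{M}^{-1}\mathrm{P}N)_i$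 for $i\in[\varsigma]$ and $\mu_0(2)=|V|-2\sum_{i=1}^\varsigma\mu_i(2)$. The pseudo-characteristic function is $\beta(\lambda)=\lambda^{\mu_0(2)}\prod_{i=1}^\varsigma(\lambda^2-\sigma_i^2)^{\mu_i(2)}$, a formal product of powers of linear factors $\lambda-\theta$ with (possibly non-integer) rational exponents; equalities between such expressions mean that the exponent of each linear factor $\lambda-\theta$, $\theta\in\mathbb{C}$, agrees on both sides. *)

(* Defs.v *)
From mathcomp Require Import all_boot all_order all_algebra.

Set Implicit Arguments.
Unset Strict Implicit.
Unset Printing Implicit Defensive.

Import GRing.Theory Num.Theory.
Local Open Scope ring_scope.

(* Graphs are pairs (vertex set, edge set) inside an ambient finite type, so
   that subgraphs of a graph are objects of the same type. *)
Definition graph (T : finType) : Type := ({set T} * {set {set T}})%type.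

Section Graphs.
Variable T : finType.
Implicit Types G H K : graph T.

Definition vset G : {set T} := G.1.
Definition eset G : {set {set T}} := G.2.

Definition simple_graph G : bool :=
  [forall a in eset G, (#|a| == 2) && (a \subset vset G)].

Definition subgraph H G : bool :=
  [&& simple_graph H, vset H \subset vset G & eset H \subset eset G].

Definition adj G : rel T := [rel x y | [set x; y] \in eset G].

Definition isomorphic H K : bool :=
  [exists f : {ffun T -> T},
    [&& dinjectiveb f (mem (vset H)), f @: vset H == vset K
      & [set f @: a | a : {set T} in eset H] == eset K]].

Definition connected G : bool :=
  (vset G != set0)
  && [forall x in vset G, forall y in vset G, connect (adj G) x y].

Definition forest G : Prop :=
  forall c : seq T, (2 < size c)%N -> ~ ucycle (adj G) c.

(* A closed walk of length n is given by its starting point w.1 and the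
   sequence w.2 of the n vertices visited next; walks with different starting
   points or directions are distinct. *)
Definition closed_walk G (n : nat) (w : T * n.-tuple T) : bool :=
  [&& w.1 \in vset G, path (adj G) w.1 w.2 & last w.1 w.2 == w.1].

Definition walk_edges (n : nat) (w : T * n.-tuple T) : seq {set T} :=
  pairmap (fun x y => [set x; y]) w.1 w.2.

Definition even_cover_walk G (n : nat) (w : T * n.-tuple T) : bool :=
  closed_walk G w &&
  [forall a in eset G,
    (0 < count_mem a (walk_edges w))%N && ~~ odd (count_mem a (walk_edges w))].

Definition num_even_cover_walks G (n : nat) : nat :=
  #|[set w : T * n.-tuple T | even_cover_walk G w]|.

Definition num_copies G H : nat :=
  #|[set K : graph T | subgraph K G && isomorphic K H]|.

(* A sign function maps each edge to a boolean b standing for (-1) ^+ b. *)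
Definition signing G : finType := {ffun {a : {set T} | a \in eset G} -> bool}.

Definition small_connected_subgraph G (s : nat) K : bool :=
  [&& subgraph K G, connected K & (#|eset K| <= s)%N].

Definition isomorphism_representatives G (s chi : nat)
    (Ghat : 'I_chi -> graph T) : Prop :=
  [/\ forall i, small_connected_subgraph G s (Ghat i),
      forall i j, isomorphic (Ghat i) (Ghat j) -> i = j
    & forall K, small_connected_subgraph G s K ->
        exists i, isomorphic K (Ghat i)].

End Graphs.

(* C plays the role of the complex numbers; algC and R[i] for a realType R are
   instances. *)
Section Matrices.
Variables (C : numClosedFieldType) (T : finType).
Implicit Types G K : graph T.

Definition adjmx G : 'M[C]_#|vset G| :=
  \matrix_(i, j) ([set enum_val i; enum_val j] \in eset G)%:R.

(* [insub] returns None exactly when the pair is not an edge. *)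
Definition signed_adjmx G (pi : signing G) : 'M[C]_#|vset G| :=
  \matrix_(i, j)
    oapp (fun a => (-1) ^+ pi a) 0 (insub [set enum_val i; enum_val j]).

Definition signed_subgraph_sq_eigenvalue G (x : C) : Prop :=
  exists (K : graph T) (pi : signing K) (z : C),
    [/\ subgraph K G, eigenvalue (signed_adjmx pi) z, z != 0 & x = z ^+ 2].

Definition enumerates_sq_eigenvalues G (s : nat) (sigma : 'I_s -> C) : Prop :=
  injective (fun i => sigma i ^+ 2) /\
  (forall x, (exists i, x = sigma i ^+ 2) <->
             signed_subgraph_sq_eigenvalue G x).

End Matrices.

(* A formal product is encoded by the function sending theta to the exponent
   of the linear factor 'X - theta; equality of formal products is [=1]. *)
Definition formal_product (C : numClosedFieldType) : Type := C -> C.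

Section FormalProducts.
Variable C : numClosedFieldType.
Implicit Types f g : formal_product C.

Definition fone : formal_product C := fun=> 0.
Definition fmul f g : formal_product C := fun theta => f theta + g theta.
Definition fpow f (a : C) : formal_product C := fun theta => a * f theta.

(* Only meaningful for monic p, as the leading coefficient is forgotten. *)
Definition fpoly (p : {poly C}) : formal_product C :=
  fun theta => (mup theta p)%:R.

End FormalProducts.

Arguments fone {C}.

Section PseudoCharacteristic.
Variables (C : numClosedFieldType) (T : finType) (G : graph T).
Variables (s : nat) (sigma : 'I_s -> C) (chi : nat) (Ghat : 'I_chi -> graph T).

(* Row l : 'I_s stands for the index l.+1 in {1, ..., s}. *)
Definition Mmx : 'M[C]_s := \matrix_(l, i) sigma i ^+ (2 * l.+1).

Definition Pmx : 'M[C]_(s, chi) :=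
  \matrix_(l, i) (num_even_cover_walks (Ghat i) (2 * l.+1))%:R.

Definition Nvec : 'cV[C]_chi := \col_i (num_copies G (Ghat i))%:R.

Definition mu (i : 'I_s) : C := 2^-1 * (invmx Mmx *m Pmx *m Nvec) i 0.

Definition mu0 : C := #|vset G|%:R - 2 * \sum_i mu i.

Definition pseudo_char : formal_product C :=
  fmul (fpow (fpoly 'X) mu0)
       (\big[@fmul C/fone]_i fpow (fpoly ('X^2 - (sigma i ^+ 2)%:P)) (mu i)).

End PseudoCharacteristic.

Definition signed_geometric_mean (C : numClosedFieldType) (T : finType)
    (G : graph T) : formal_product C :=
  \big[@fmul C/fone]_(pi : signing G)
     fpow (fpoly (char_poly (signed_adjmx C pi))) (2 ^- #|eset G|).

Arguments signed_geometric_mean C {T} G.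

(* Main.v *)
(* Averaging tr(A_pi^k) over all signings pi leaves exactly the closed walks of
   length k that use every edge an even number of times.  Such a walk of length
   2l covers a unique connected subgraph, which has at most l edges, so for
   1 <= l <= s these averaged power sums are the entries of P N.  On the other
   hand they are the power sums of the averaged eigenvalue multiplicities, which
   are invariant under theta |-> -theta because pi can be negated; inverting the
   Vandermonde-like matrix M therefore recovers the averaged multiplicities.
   Finally, power sums determine multiplicities, so the geometric mean is the
   characteristic polynomial of G iff every closed walk of G uses each edge an
   even number of times, and this fails precisely when G has a cycle. *)
Require Import Defs.
From mathcomp Require Import all_boot all_order all_algebra.
From mathcomp Require Import spectral zify.
Set Implicit Arguments.
Unset Strict Implicit.
Unset Printing Implicit Defensive.
Import Order.TTheory GRing.Theory Num.Theory.
Local Open Scope ring_scope.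

(** * Spectra of real symmetric matrices, and weighted power sums *)

Lemma char_poly_conj (F : fieldType) n (P A : 'M[F]_n) :
  P \in unitmx -> char_poly (invmx P *m A *m P) = char_poly A.
Proof.
move=> Pu; rewrite /char_poly /char_poly_mx.
have PVP : map_mx polyC (invmx P) *m map_mx polyC P = 1%:M.
  by rewrite -map_mxM mulVmx // map_mx1.
have -> : 'X%:M - map_mx polyC (invmx P *m A *m P) =
    map_mx polyC (invmx P) *m ('X%:M - map_mx polyC A) *m map_mx polyC P.
  by rewrite mulmxBr mulmxBl !map_mxM scalar_mxC -!mulmxA PVP mulmx1.
rewrite !det_mulmx mulrC mulrA -det_mulmx (_ : _ *m _ = 1%:M) ?det1 ?mul1r //.
by rewrite -map_mxM mulmxV // map_mx1.
Qed.

Lemma mxtrace_expr_conj (F : fieldType) n (P A : 'M[F]_n) k :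
  P \in unitmx -> \tr ((invmx P *m A *m P) ^+ k) = \tr (A ^+ k).
Proof.
move=> Pu; suff -> : (invmx P *m A *m P) ^+ k = invmx P *m (A ^+ k) *m P.
  by rewrite -mulmxA mxtrace_mulC -mulmxA mulmxV // mulmx1.
elim: k => [|k IHk]; first by rewrite !expr0 mulmx1 mulVmx.
by rewrite !exprS IHk -!mulmxE !mulmxA mulmxK.
Qed.

Lemma diag_mx_expr (R : comNzRingType) n (d : 'rV[R]_n) k :
  diag_mx d ^+ k = diag_mx (\row_j d 0 j ^+ k).
Proof.
elim: k => [|k IHk].
  by apply/matrixP => i j; rewrite !mxE expr0.
rewrite exprS IHk -mulmxE mulmx_diag; congr diag_mx.
by apply/rowP => j; rewrite !mxE exprS.
Qed.

Lemma char_poly_diag (R : comNzRingType) n (d : 'rV[R]_n) :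
  char_poly (diag_mx d) = \prod_i ('X - (d 0 i)%:P).
Proof.
rewrite char_poly_trig ?diag_mx_is_trig //.
by apply: eq_bigr => i _; rewrite mxE eqxx mulr1n.
Qed.

(** A real symmetric matrix is normal, hence unitarily diagonalisable. All three clauses are read
    off the same diagonal, so a single [d] serves the multiplicities of [A], those of [- A] and the
    traces. *)
Lemma real_symmetric_spectrum (C : numClosedFieldType) n (A : 'M[C]_n) :
    A \is symmetricmx -> A \is a mxOver Num.real ->
  exists d : 'I_n -> C,
    [/\ forall x, mup x (char_poly A) = #|[set i | d i == x]|,
        forall x, mup x (char_poly (- A)) = #|[set i | d i == - x]|
      & forall k, \tr (A ^+ k) = \sum_i d i ^+ k].
Proof.
move=> symA realA.
have /orthomx_spectralP := symmetric_normalmx symA realA.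
set P := spectralmx A; set d := spectral_diag A => /= defA.
have Pu : P \in unitmx by apply/unitarymx_unit/spectral_unitarymx.
have mupE (e : 'I_n -> C) x :
    mup x (\prod_i ('X - (e i)%:P)) = #|[set i | e i == x]|.
  rewrite -(big_map e xpredT (fun y => 'X - y%:P)) mu_prod_XsubC.
  by rewrite count_map cardsE cardE size_filter.
exists (d 0); split=> [x|x|k].
- by rewrite defA char_poly_conj // char_poly_diag mupE.
- rewrite defA -mulNmx -mulmxN char_poly_conj // -raddfN char_poly_diag mupE.
  by congr #|pred_of_set _|; apply/setP => i; rewrite !inE mxE eqr_oppLR.
rewrite {1}defA mxtrace_expr_conj // diag_mx_expr mxtrace_diag.
by apply: eq_bigr => i _; rewrite mxE.
Qed.

(* Power sums extend linearly to polynomials, and some polynomial separates x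
   from the other points. *)
Lemma power_sums_eq0 (F : fieldType) (I : finType) (w x : I -> F) :
    (forall k, \sum_i w i * x i ^+ k = 0) ->
  forall y, \sum_(i | x i == y) w i = 0.
Proof.
move=> pow0 y.
have poly0 (p : {poly F}) : \sum_i w i * p.[x i] = 0.
  under eq_bigr => i _ do rewrite horner_coef mulr_sumr.
  rewrite exchange_big big1 //= => k _.
  under eq_bigr => i _ do rewrite mulrCA.
  by rewrite -mulr_sumr pow0 mulr0.
pose p := \prod_(z <- rem y (undup (codom x))) ('X - z%:P).
have uz : uniq (undup (codom x)) by apply: undup_uniq.
have py : p.[y] != 0.
  by rewrite -rootE root_prod_XsubC mem_rem_uniq // inE eqxx.
apply: (mulIf py); rewrite mul0r -[RHS](poly0 p) mulr_suml big_mkcond.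
apply: eq_bigr => i _; case: eqVneq => [-> //|xy].
rewrite (rootP _) ?mulr0 // root_prod_XsubC mem_rem_uniq // inE xy /=.
by rewrite mem_undup codom_f.
Qed.

Lemma sum_eq_seq (V : nmodType) (Y : eqType) (r : seq Y) (v : Y) (F : Y -> V) :
  uniq r -> v \in r -> \sum_(y <- r | v == y) F y = F v.
Proof.
move=> ur vr; rewrite big_mkcond (bigD1_seq v) //= eqxx big1 ?addr0 // => y.
by rewrite eq_sym => /negbTE->.
Qed.

(** Converse of [power_sums_eq0]: grouping the points by their value makes each fiber sum a
    factor. *)
Lemma vanishing_fibers_power_sums (F : fieldType) (I : finType) (w x : I -> F) :
    (forall y, \sum_(i | x i == y) w i = 0) ->
  forall k, \sum_i w i * x i ^+ k = 0.
Proof.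
move=> fib0 k; pose r := undup (codom x).
transitivity (\sum_i \sum_(y <- r | x i == y) w i * y ^+ k).
  apply: eq_bigr => i _; rewrite sum_eq_seq ?undup_uniq //.
  by rewrite mem_undup codom_f.
rewrite (exchange_big_dep xpredT) //= big1 // => y _.
by rewrite -mulr_suml fib0 mul0r.
Qed.

Lemma big_cons_tuple (V : nmodType) (T : finType) k (P : pred (k.+1.-tuple T))
    (F : k.+1.-tuple T -> V) :
  \sum_(w | P w) F w = \sum_x \sum_(w : k.-tuple T | P [tuple of x :: w]) F [tuple of x :: w].
Proof.
rewrite pair_big_dep /= (reindex (fun u : T * k.-tuple T => [tuple of u.1 :: u.2])) //=.
exists (fun w => (thead w, [tuple of behead w])) => [[x w] _|w _] /=.
  by congr (_, _); apply: val_inj.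
by rewrite [RHS]tuple_eta.
Qed.

(** * Traces as weighted counts of closed walks, and their sum over all signings *)

Section Walks.
Variable T : finType.
Implicit Types (G H K : graph T) (x y : T) (p q : seq T).

Lemma simple_edge_sub G a : simple_graph G -> a \in eset G -> a \subset vset G.
Proof. by move=> /forall_inP sG /sG/andP[]. Qed.

Definition path_edges x p : seq {set T} :=
  pairmap (fun x y => [set x; y]) x p.

Lemma path_adjE G x p : path (adj G) x p = all (mem (eset G)) (path_edges x p).
Proof. by elim: p x => //= y p IHp x; rewrite IHp. Qed.

Definition even_edges (es : seq {set T}) : bool :=
  [forall a, ~~ odd (count_mem a es)].

Definition even_closed_walk G n (w : T * n.-tuple T) : bool :=
  closed_walk G w && even_edges (walk_edges w).

Section Traces.
Variable R : comNzRingType.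

(** The tuples range over all of [T], not only over [V]. The hypothesis on [g] gives weight 0 to
    every edge that leaves [V], so the surplus walks contribute nothing. *)
Lemma edge_weight_mx_expr (V : {set T}) (g : {set T} -> R) k i j :
    (forall a : {set T}, ~~ (a \subset V) -> g a = 0) ->
  ((\matrix_(i < #|V|, j < #|V|) g [set enum_val i; enum_val j]) ^+ k) i j =
  \sum_(w : k.-tuple T | last (enum_val i) w == enum_val j)
     \prod_(a <- path_edges (enum_val i) w) g a.
Proof.
move=> g0; elim: k i j => [|k IHk] i j.
  rewrite expr0 mxE big_mkcond (bigD1 [tuple]) //= [X in _ + X]big1 ?addr0 => [|w].
    by rewrite big_nil (inj_eq enum_val_inj); case: (i == j).
  by case/eqP; apply: tuple0.
rewrite exprS -mulmxE mxE big_cons_tuple /=.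
rewrite (bigID [in V]) /= [X in _ + X]big1 ?addr0 => [|x xV]; last first.
  apply: big1 => w _; rewrite big_cons g0 ?mul0r //.
  by apply: contra xV => /subsetP->; rewrite // !inE eqxx orbT.
rewrite (big_enum_val (fun x => \sum_(w : k.-tuple T | last x w == _) _)) /=.
apply: eq_bigr => l _; rewrite mxE IHk mulr_sumr.
by apply: eq_bigr => w _; rewrite big_cons.
Qed.

Lemma edge_weight_mx_trace (V : {set T}) (g : {set T} -> R) k :
    (forall a : {set T}, ~~ (a \subset V) -> g a = 0) ->
  \tr ((\matrix_(i < #|V|, j < #|V|) g [set enum_val i; enum_val j]) ^+ k) =
  \sum_(w : T * k.-tuple T | (w.1 \in V) && (last w.1 w.2 == w.1))
     \prod_(a <- walk_edges w) g a.
Proof.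
move=> g0; rewrite /mxtrace -(pair_big_dep [in V] (fun x (w : k.-tuple T) =>
  last x w == x) (fun x w => \prod_(a <- walk_edges (x, w)) g a)) /=.
rewrite (big_enum_val (fun x => \sum_(w : k.-tuple T | last x w == _) _)) /=.
by apply: eq_bigr => i _; rewrite edge_weight_mx_expr.
Qed.

Lemma prod_count_mem (D : {pred {set T}}) (g : {set T} -> R) (es : seq {set T}) :
    all D es ->
  \prod_(a <- es) g a =
  \prod_(b : {a | D a}) g (val b) ^+ count_mem (val b) es.
Proof.
elim: es => [_|a es IHes /= /andP[Da Des]].
  by rewrite big_nil big1 // => b _; rewrite expr0.
rewrite big_cons IHes //; under [RHS]eq_bigr do rewrite exprD.
rewrite big_split /=; congr (_ * _).
rewrite (bigD1 (exist (fun a => D a) a Da)) //= eqxx expr1.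
rewrite big1 ?mulr1 // => b bDa.
by rewrite eq_sym (negbTE (_ : val b != a)) ?expr0.
Qed.

End Traces.

Lemma closed_walkE G n (w : T * n.-tuple T) :
  closed_walk G w =
  ((w.1 \in vset G) && (last w.1 w.2 == w.1)) &&
    all (mem (eset G)) (walk_edges w).
Proof. by rewrite /closed_walk path_adjE andbAC andbA. Qed.

Section Signings.
Variables (C : numClosedFieldType) (G : graph T).

Definition edge_sign (pi : signing G) (a : {set T}) : C :=
  oapp (fun b => (-1) ^+ pi b) 0 (insub a).

Lemma edge_sign_val pi (b : {a | a \in eset G}) :
  edge_sign pi (val b) = (-1) ^+ pi b.
Proof. by rewrite /edge_sign valK. Qed.

Lemma edge_sign_out pi a : a \notin eset G -> edge_sign pi a = 0.
Proof. by move=> aG; rewrite /edge_sign insubN. Qed.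

(** By distributivity the sum factors over the edges of [G]. An edge occurring [m] times contributes
    [1 + (-1) ^+ m], which is 2 for even [m] and 0 for odd [m]. *)
Lemma sum_prod_edge_sign (es : seq {set T}) :
  \sum_(pi : signing G) \prod_(a <- es) edge_sign pi a =
  2 ^+ #|eset G| * (all (mem (eset G)) es && even_edges es)%:R.
Proof.
case: (boolP (all _ es)) => [esG|/allPn[a aes aG]] /=; last first.
  rewrite mulr0 big1 // => pi _.
  by rewrite (big_rem a) //= edge_sign_out // mul0r.
pose F (b : {a | a \in eset G}) (e : bool) : C :=
  ((-1) ^+ e) ^+ count_mem (val b) es.
transitivity (\sum_(pi : signing G) \prod_b F b (pi b)).
  apply: eq_bigr => pi _; rewrite (prod_count_mem _ esG).
  by apply: eq_bigr => b _; rewrite edge_sign_val.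
rewrite -bigA_distr_bigA.
have sumF b : \sum_e F b e = (-1) ^+ odd (count_mem (val b) es) + 1.
  by rewrite big_bool /F expr1n expr1 signr_odd.
under eq_bigr => b _ do rewrite sumF.
case: (boolP (even_edges es)) => [/forallP ev|].
  under eq_bigr => b _ do rewrite (negbTE (ev _)).
  by rewrite prodr_const card_sig mulr1 [in RHS]mulr2n; congr (_ ^+ _); apply: eq_card.
rewrite negb_forall => /existsP[a]; rewrite negbK mulr0 => odda.
have aG : a \in eset G.
  apply: (allP esG); rewrite -has_pred1 has_count lt0n.
  by apply: contraTneq odda => ->.
by rewrite (bigD1 (exist _ a aG)) //= odda expr1 addNr mul0r.
Qed.

Hypothesis sG : simple_graph G.

Lemma signed_adjmx_trace (pi : signing G) k :
  \tr (signed_adjmx C pi ^+ k) =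
  \sum_(w : T * k.-tuple T | (w.1 \in vset G) && (last w.1 w.2 == w.1))
     \prod_(a <- walk_edges w) edge_sign pi a.
Proof.
apply: edge_weight_mx_trace => a aV; apply: edge_sign_out.
by apply: contra aV; apply: simple_edge_sub.
Qed.

Lemma sum_signed_adjmx_trace k :
  \sum_(pi : signing G) \tr (signed_adjmx C pi ^+ k) =
  2 ^+ #|eset G| * #|[set w : T * k.-tuple T | even_closed_walk G w]|%:R.
Proof.
under eq_bigr => pi _ do rewrite signed_adjmx_trace.
rewrite exchange_big /= -[#|[set _ | _]|]sum1_card natr_sum mulr_sumr.
under eq_bigr => w _ do rewrite sum_prod_edge_sign.
rewrite [RHS]big_mkcond [LHS]big_mkcond; apply: eq_bigr => w _ /=.
rewrite inE /even_closed_walk closed_walkE -andbA.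
by case: (_ && (_ == _)) => //=; case: (_ && _); rewrite ?mulr1 ?mulr0.
Qed.

Lemma adjmx_trace k :
  \tr (adjmx C G ^+ k) = #|[set w : T * k.-tuple T | closed_walk G w]|%:R.
Proof.
rewrite (edge_weight_mx_trace k (g := fun a => (a \in eset G)%:R)) => [|a aV]; last first.
  by case: (boolP (a \in _)) aV => // /(simple_edge_sub sG) ->.
rewrite -sum1_card natr_sum [LHS]big_mkcond [RHS]big_mkcond /=.
apply: eq_bigr => w _; rewrite inE closed_walkE.
case: (_ && (_ == _)) => //=; elim: (walk_edges w) => [|a es IHes].
  by rewrite big_nil.
by rewrite big_cons IHes /=; case: (a \in _); rewrite ?mul1r ?mul0r.
Qed.

End Signings.
End Walks.

(** * Even closed walks sorted by the connected subgraph they cover *)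

Section EvenWalkSupports.
Variable T : finType.
Implicit Types (G H K : graph T) (x y : T) (p q : seq T).

Lemma path_edges_sub x p a y : a \in path_edges x p -> y \in a -> y \in x :: p.
Proof.
elim: p x => //= z p IHp x; rewrite inE => /orP[/eqP->|ap ya].
  by rewrite !inE => /orP[]->; rewrite ?orbT.
by rewrite inE IHp // orbT.
Qed.

Lemma mem_path_edges x p y :
  y \in p -> exists2 a, a \in path_edges x p & y \in a.
Proof.
elim: p x => //= z p IHp x; rewrite inE => /orP[/eqP->|/(IHp z)[a ap ya]].
  by exists [set x; z]; rewrite !inE eqxx ?orbT.
by exists a; rewrite // inE ap orbT.
Qed.

Lemma adj_sym G : symmetric (adj G).
Proof. by move=> x y; rewrite /adj /= setUC. Qed.

Lemma path_adj_vset G x p : simple_graph G -> x \in vset G ->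
  path (adj G) x p -> {subset x :: p <= vset G}.
Proof.
move=> sG xG; rewrite path_adjE => /allP pG y.
rewrite inE => /orP[/eqP-> // | /(mem_path_edges x)[a /pG aG ya]].
exact: subsetP (simple_edge_sub sG aG) y ya.
Qed.

Definition walk_support n (w : T * n.-tuple T) : graph T :=
  ([set x in w.1 :: w.2], [set a in walk_edges w]).

Lemma path_walk_support n (w : T * n.-tuple T) :
  path (adj (walk_support w)) w.1 w.2.
Proof. by rewrite path_adjE; apply/allP => a aw; rewrite /= inE. Qed.

Lemma connected_walk_support n (w : T * n.-tuple T) :
  connected (walk_support w).
Proof.
apply/andP; split; first by apply/set0Pn; exists w.1; rewrite !inE eqxx.
have toP y : y \in vset (walk_support w) -> connect (adj (walk_support w)) w.1 y.
  by rewrite in_set => yw; apply: path_connect (path_walk_support w) y yw.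
apply/forall_inP => x /toP wx; apply/forall_inP => y /toP; apply: connect_trans.
by rewrite (sym_connect_sym (@adj_sym _)).
Qed.

Lemma closed_walk_support G n (w : T * n.-tuple T) :
  simple_graph G -> closed_walk G w -> subgraph (walk_support w) G.
Proof.
move=> sG /and3P[wV wE _]; have wsub := path_adj_vset sG wV wE.
move: wE; rewrite path_adjE => /allP wE.
apply/and3P; split; last 2 first.
- by apply/subsetP => y; rewrite in_set; apply: wsub.
- by apply/subsetP => a; rewrite inE; apply: wE.
apply/forall_inP => a; rewrite inE => aw.
have /forall_inP/(_ a (wE a aw))/andP[-> _] := sG.
by apply/subsetP => y ya; rewrite in_set (path_edges_sub aw).
Qed.

(** An edge that occurs an even number of times, and at least once, occurs at least twice. *)
Lemma even_edges_card (es : seq {set T}) :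
  even_edges es -> (2 * #|[set a in es]| <= size es)%N.
Proof.
move=> /forallP ev; rewrite -sum1_size big_seq_cond mulnC -sum_nat_const.
rewrite [X in (_ <= X)%N](partition_big id [in es]) => [|a /andP[]//] /=.
rewrite (eq_bigl [in es]) => [|a]; last by rewrite in_set.
apply: leq_sum => a aes; rewrite (eq_bigl (pred1 a)) => [|b /=]; last first.
  by rewrite andbT andb_idl // => /eqP->.
rewrite sum1_count; have := ev a; have : (0 < count_mem a es)%N.
  by rewrite -has_count has_pred1.
by case: (count_mem a es) => [|[]].
Qed.

Lemma even_walk_support_small G s n (w : T * n.-tuple T) :
    simple_graph G -> (n <= 2 * s)%N -> even_closed_walk G w ->
  small_connected_subgraph G s (walk_support w).
Proof.
move=> sG ns /andP[wG wev]; apply/and3P; split.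
- exact: closed_walk_support.
- exact: connected_walk_support.
rewrite -(leq_pmul2l (isT : 0 < 2)%N) (leq_trans _ ns) //.
by rewrite (leq_trans (even_edges_card wev)) // size_pairmap size_tuple.
Qed.

Lemma walk_edges_count0 K n (w : T * n.-tuple T) a :
  closed_walk K w -> a \notin eset K -> count_mem a (walk_edges w) = 0%N.
Proof.
case/and3P=> _; rewrite path_adjE => /allP wK _ aK; apply/count_memPn.
by apply: contra aK => /wK.
Qed.

Lemma sub_closed_walk G K n (w : T * n.-tuple T) :
  subgraph K G -> closed_walk K w -> closed_walk G w.
Proof.
case/and3P=> _ /subsetP KV /subsetP KE /and3P[/KV wV wE wl].
rewrite /closed_walk wV wl andbT; apply: sub_path wE => x y; exact: KE.
Qed.

Lemma even_cover_walk_support K n (w : T * n.-tuple T) :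
  simple_graph K -> connected K -> even_cover_walk K w -> walk_support w = K.
Proof.
move=> sK /andP[_ /forall_inP cK] /andP[wK /forall_inP cov].
have /and3P[wV wE _] := wK.
have KE : eset (walk_support w) = eset K.
  apply/setP => a; rewrite in_set; apply/idP/idP => [|/cov/andP[]].
    by move: a; apply/allP; rewrite -[all _ _]path_adjE.
  by rewrite -has_count has_pred1.
have KV : vset (walk_support w) = vset K.
  apply/setP => y; rewrite in_set; apply/idP/idP.
    exact: path_adj_vset sK wV wE y.
  (* By connectedness [y] is the starting point or the end of an edge of [K], and the walk traverses
     every edge of [K]. *)
  move=> yK; have /forall_inP/(_ y yK)/connectP[p pE ->] := cK _ wV.
  case/lastP: p pE => [|p z]; first by rewrite mem_head.
  rewrite rcons_path last_rcons /adj /= -KE in_set => /andP[_ /path_edges_sub].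
  by apply; rewrite !inE eqxx orbT.
by rewrite [RHS]surjective_pairing -[K.1]KV -[K.2]KE.
Qed.

Lemma even_closed_walk_supportE G K n (w : T * n.-tuple T) :
    subgraph K G -> connected K ->
  even_closed_walk G w && (walk_support w == K) = even_cover_walk K w.
Proof.
move=> sKG cK; have /and3P[sK _ _] := sKG.
apply/idP/idP => [/andP[/andP[wG /forallP wev] /eqP <-]|wK]; last first.
  rewrite (even_cover_walk_support sK cK wK) eqxx andbT.
  case/andP: (wK) => wcK /forall_inP cov.
  rewrite /even_closed_walk (sub_closed_walk sKG wcK); apply/forallP => a.
  by case: (boolP (a \in eset K)) => [/cov/andP[]|/(walk_edges_count0 wcK)->].
have /and3P[_ _ wl] := wG.
rewrite /even_cover_walk /closed_walk path_walk_support wl !inE eqxx /=.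
apply/forall_inP => a; rewrite in_set => aw.
by rewrite wev -has_count has_pred1 aw.
Qed.

(** The walks are partitioned by [walk_support]: the bound on [n] makes every support small, and
    [even_closed_walk_supportE] identifies the fiber over [K]. *)
Lemma card_even_closed_walks G s n :
    simple_graph G -> (n <= 2 * s)%N ->
  #|[set w : T * n.-tuple T | even_closed_walk G w]| =
  (\sum_(K | small_connected_subgraph G s K) num_even_cover_walks K n)%N.
Proof.
move=> sG ns; rewrite -sum1_card.
rewrite (partition_big (@walk_support n) (small_connected_subgraph G s)) /=.
  apply: eq_bigr => K /and3P[sK cK _]; rewrite /num_even_cover_walks -sum1_card.
  by apply: eq_bigl => w; rewrite !inE even_closed_walk_supportE.
by move=> w; rewrite inE; apply: even_walk_support_small.
Qed.

End EvenWalkSupports.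

(** * Isomorphism invariance and counting by representatives *)

Section Isomorphisms.
Variable T : finType.
Implicit Types (G H K L : graph T) (f g : T -> T).

(** Injectivity on the vertices is traded for a left inverse [g], which makes inversion and
    composition of isomorphisms direct. *)
Lemma isomorphicP H K :
  reflect (exists f g, [/\ {in vset H, cancel f g}, f @: vset H = vset K
             & [set f @: a | a : {set T} in eset H] = eset K])
          (isomorphic H K).
Proof.
apply: (iffP existsP) => [[f /and3P[finj /eqP fV /eqP fE]] | [f [g [fg fV fE]]]].
  (* The default [y] is only taken outside the image of [vset H], where the value of the inverse is
     immaterial. *)
  exists f, (fun y => odflt y [pick x in vset H | f x == y]); split=> // x xH.
  case: pickP => [z /andP[zH /eqP fzx]|/(_ x)]; last by rewrite /= xH eqxx.
  exact: (dinjectiveP _ _ finj z x).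
exists (finfun f); apply/and3P; split.
- apply/dinjectiveP => x y xH yH; rewrite !ffunE => fxy.
  by rewrite -(fg x xH) fxy fg.
- by rewrite -fV; apply/eqP; apply: eq_imset => x; rewrite ffunE.
rewrite -fE; apply/eqP; apply: eq_imset => a.
by apply: eq_imset => x; rewrite ffunE.
Qed.

Lemma imset_cancel (V a : {set T}) f g :
  {in V, cancel f g} -> a \subset V -> g @: (f @: a) = a.
Proof.
move=> fg /subsetP aV; rewrite -imset_comp -[RHS]imset_id.
by apply: eq_in_imset => x /aV/fg.
Qed.

(** Simplicity puts each edge of [H] inside [vset H], where [g] undoes [f]. *)
Lemma isomorphic_sym H K : simple_graph H -> isomorphic H K -> isomorphic K H.
Proof.
move=> sH /isomorphicP[f [g [fg fV fE]]]; apply/isomorphicP; exists g, f.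
split; first by rewrite -fV => _ /imsetP[x xH ->]; rewrite fg.
  by rewrite -fV (imset_cancel fg).
rewrite -fE -imset_comp -[RHS]imset_id; apply: eq_in_imset => a aH /=.
by rewrite (imset_cancel fg) // simple_edge_sub.
Qed.

Lemma isomorphic_trans H K L :
  isomorphic H K -> isomorphic K L -> isomorphic H L.
Proof.
move=> /isomorphicP[f [g [fg fV fE]]] /isomorphicP[f' [g' [fg' fV' fE']]].
apply/isomorphicP; exists (f' \o f), (g \o g'); split.
- by move=> x xH /=; rewrite fg' ?fg // -fV imset_f.
- by rewrite imset_comp fV fV'.
rewrite -fE' -fE -imset_comp; apply: eq_imset => a.
by rewrite /= -imset_comp.
Qed.

Lemma isomorphic_path H K f x p :
    [set f @: a | a : {set T} in eset H] = eset K -> path (adj H) x p ->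
  path (adj K) (f x) (map f p).
Proof.
move=> fE; elim: p x => //= y p IHp x /andP[xy /IHp ->]; rewrite andbT.
by rewrite /adj /= -fE -(imset_set1 f x) -(imset_set1 f y) -imsetU imset_f.
Qed.

Lemma isomorphic_connected H K :
  isomorphic H K -> connected H -> connected K.
Proof.
move=> /isomorphicP[f [g [fg fV fE]]] /andP[/set0Pn[x xH] /forall_inP cH].
apply/andP; split; first by apply/set0Pn; exists (f x); rewrite -fV imset_f.
apply/forall_inP => _ /[!(esym fV)] /imsetP[y yH ->].
apply/forall_inP => _ /imsetP[z zH ->].
have /forall_inP/(_ z zH)/connectP[p pH ->] := cH y yH.
by apply/connectP; exists (map f p); rewrite ?last_map // (isomorphic_path fE).
Qed.

Lemma isomorphic_card_eset H K : isomorphic H K -> (#|eset K| <= #|eset H|)%N.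
Proof. by move=> /isomorphicP[f [g [_ _ <-]]]; apply: leq_imset_card. Qed.

Lemma path_edges_map f x p :
  path_edges (f x) (map f p) = [seq f @: a | a : {set T} <- path_edges x p].
Proof. by elim: p x => //= y p IHp x; rewrite IHp imsetU !imset_set1. Qed.

(** Applying [f] vertex by vertex injects the walks of [H] into those of [K]. Edge multiplicities
    are preserved because [f] is injective on the edges of [H]. *)
Lemma isomorphic_leq_even_cover_walks H K n : simple_graph H ->
  isomorphic H K -> (num_even_cover_walks H n <= num_even_cover_walks K n)%N.
Proof.
move=> sH /isomorphicP[f [g [fg fV fE]]].
pose F (w : T * n.-tuple T) := (f w.1, map_tuple f w.2).
rewrite /num_even_cover_walks -(card_in_imset (f := F)).
  apply/subset_leq_card/subsetP => _ /imsetP[w /[!inE] /andP[wH cov] ->].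
  have /and3P[wV wE wl] := wH.
  rewrite /even_cover_walk /closed_walk /= -{1}fV imset_f //.
  rewrite (isomorphic_path fE) // last_map (eqP wl) eqxx /=.
  apply/forall_inP => b /[!(esym fE)] /imsetP[a aH ->].
  suff -> : count_mem (f @: a) (walk_edges (F w)) = count_mem a (walk_edges w).
    exact: (forall_inP cov).
  rewrite /walk_edges -/(path_edges _ _) path_edges_map count_map.
  apply: eq_in_count => c cw /=; apply/eqP/eqP => [fca|-> //].
  have cH : c \in eset H by move: c cw {fca}; apply/allP; rewrite -path_adjE.
  by rewrite -(imset_cancel fg (simple_edge_sub sH cH)) fca
             (imset_cancel fg (simple_edge_sub sH aH)).
move=> [x p] [y q] /[!inE] /andP[/and3P[xV xE _] _] /andP[/and3P[yV yE _] _].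
move=> [] fxy fpq; congr (_, _); first by rewrite -(fg x xV) fxy fg.
(* A walk in [H] stays in [vset H], so [g] recovers it from its image. *)
have gf z r : z \in vset H -> path (adj H) z r -> map g (map f r) = r.
  move=> zV zr; rewrite -map_comp -[RHS]map_id; apply/eq_in_map => t tr.
  by rewrite /= fg // (path_adj_vset sH zV zr) // inE tr orbT.
by apply: val_inj; rewrite /= -(gf x p xV xE) fpq (gf y q yV yE).
Qed.

Lemma isomorphic_even_cover_walks H K n :
    simple_graph H -> simple_graph K -> isomorphic H K ->
  num_even_cover_walks H n = num_even_cover_walks K n.
Proof.
move=> sH sK HK; apply/eqP; rewrite eqn_leq !isomorphic_leq_even_cover_walks //.
exact: isomorphic_sym.
Qed.

(** Double counting of the pairs of a representative and one of its copies: each small connected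
    subgraph is a copy of exactly one representative. *)
Lemma sum_isomorphism_representatives G s chi (Ghat : 'I_chi -> graph T) n :
    isomorphism_representatives G s Ghat ->
  (\sum_(K | small_connected_subgraph G s K) num_even_cover_walks K n =
   \sum_i num_copies G (Ghat i) * num_even_cover_walks (Ghat i) n)%N.
Proof.
move=> [Gsmall Ginj Gsurj].
have sGhat i : simple_graph (Ghat i) by have /and3P[/and3P[]] := Gsmall i.
(* [num_copies] does not ask for copies to be small or connected; both properties are inherited from
   the representative. *)
have copyE i K : subgraph K G && isomorphic K (Ghat i) =
                 small_connected_subgraph G s K && isomorphic K (Ghat i).
  case: (boolP (isomorphic K _)) => [KG|_]; last by rewrite !andbF.
  rewrite !andbT; apply/idP/and3P => [sKG|[] //].
  have sK : simple_graph K by case/and3P: sKG.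
  have GK := isomorphic_sym sK KG; have /and3P[_ cG leG] := Gsmall i.
  split=> //; first exact: isomorphic_connected GK cG.
  exact: leq_trans (isomorphic_card_eset GK) leG.
under [RHS]eq_bigr => i _ do rewrite -sum_nat_const.
rewrite (exchange_big_dep (small_connected_subgraph G s)) /=; last first.
  by move=> i K _; rewrite inE copyE => /andP[].
apply: eq_bigr => K sK; have [i Ki] := Gsurj K sK.
have /and3P[/and3P[sgK _ _] _ _] := sK.
rewrite (big_pred1 i) => [|j /=]; first exact: isomorphic_even_cover_walks.
rewrite inE copyE sK /=; apply/idP/eqP => [Kj|-> //].
by apply/Ginj/(isomorphic_trans _ Ki)/isomorphic_sym.
Qed.

End Isomorphisms.

(** * Closed walks in forests *)

Section Forests.
Variable T : finType.
Implicit Types (G : graph T) (x y : T) (p q c : seq T).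

Lemma path_edges_cat x p q :
  path_edges x (p ++ q) = path_edges x p ++ path_edges (last x p) q.
Proof. exact: pairmap_cat. Qed.

Lemma even_edges_cat (es es' : seq {set T}) :
  even_edges es -> even_edges es' -> even_edges (es ++ es').
Proof.
move=> /forallP ev /forallP ev'; apply/forallP => a.
by rewrite count_cat oddD (negbTE (ev a)) ev'.
Qed.

Lemma even_edges_perm (es es' : seq {set T}) :
  perm_eq es es' -> even_edges es = even_edges es'.
Proof.
by move=> /permP eqes; apply: eq_forallb => a; rewrite eqes.
Qed.

Lemma not_uniq_split p : ~~ uniq p ->
  exists y p1 p2 p3, p = rcons p1 y ++ rcons p2 y ++ p3.
Proof.
elim: p => //= z p IHp; rewrite negb_and negbK => /orP[|/IHp].
  by case/splitPr=> p2 p3; exists z, [::], p2, p3; rewrite /= cat_rcons.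
by case=> y [p1 [p2 [p3 ->]]]; exists y, (z :: p1), p2, p3.
Qed.

(* A shortest closed walk using some edge an odd number of times has no repeated
   vertex, as it would otherwise split into two shorter closed walks. *)
Lemma forest_even_closed_path G x p : simple_graph G -> forest G ->
  path (adj G) x p -> last x p = x -> even_edges (path_edges x p).
Proof.
move=> sG fG; have [n] := ubnP (size p).
elim: n x p => // n IHn x p pn xp lp; case: (boolP (uniq p)) => [up|].
  (* With no repeated vertex, length 0 is trivial, length 1 would be a loop, length 2 uses one edge
     twice, and a greater length gives a cycle. *)
  case: p pn xp lp up => [|y [|z p]].
  - by move=> *; apply/forallP.
  - move=> _ /= /andP[+ _] yx _; rewrite yx => xG.
    have /forall_inP/(_ _ xG) := sG.
    by rewrite setUid cards1.
  - move=> pn xp /= lp up; case: p pn xp lp up => [|t p] pn xp lp up.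
      rewrite /= in lp; rewrite lp; apply/forallP => a /=.
      by rewrite [ [set y; x] ]setUC addn0 oddD addbb.
    case: (fG [:: y, z, t & p]) => //; rewrite /ucycle /= in xp lp up *.
    rewrite up andbT rcons_path lp.
    by case/and4P: xp => -> -> -> ->.
case/not_uniq_split => y [p1 [p2 [p3 defp]]].
rewrite defp !cat_path !last_rcons in xp; have /and3P[xp1 yp2 yp3] := xp.
rewrite defp !last_cat last_rcons in lp.
rewrite defp !size_cat !size_rcons in pn.
(* The stretch from [y] back to [y] is moved to the front; it and the remainder are both shorter
   closed walks. *)
rewrite defp !path_edges_cat !last_rcons (even_edges_perm (permEl (perm_catCA _ _ _))).
apply: even_edges_cat.
  by apply: IHn; rewrite ?size_rcons ?last_rcons //; lia.
rewrite -{2}(last_rcons x p1 y) -path_edges_cat.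
apply: IHn; rewrite ?last_cat ?last_rcons // ?cat_path ?last_rcons ?xp1 //.
by rewrite size_cat size_rcons; lia.
Qed.

(** Going once around a cycle uses its first edge exactly once: the second edge misses [x], and all
    later ones miss [y]. *)
Lemma even_closed_path_forest G :
    simple_graph G ->
    (forall x p, x \in vset G -> path (adj G) x p -> last x p = x ->
       even_edges (path_edges x p)) ->
  forest G.
Proof.
move=> sG ev [|x [|y [|z p]]] // _ /andP[cyc uc].
have xy : [set x; y] \in eset G by case/andP: cyc.
have xG : x \in vset G.
  by apply: (subsetP (simple_edge_sub sG xy)); rewrite !inE eqxx.
have := ev x (rcons [:: y, z & p] x) xG cyc; rewrite last_rcons => /(_ erefl).
move=> /forallP/(_ [set x; y])/negP; apply.
move: uc; rewrite /= !inE !negb_or => /and4P[/and3P[xny xnz xp] /andP[ynz yp] _ _].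
rewrite eqxx (_ : [set y; z] == _ = false); last first.
  by apply/eqP => /setP/(_ x); rewrite !inE eqxx (negbTE xny) (negbTE xnz).
rewrite (count_memPn _) //; apply: (contra (fun a => path_edges_sub a (_ : y \in _))).
  by rewrite !inE eqxx orbT.
by rewrite inE mem_rcons inE !negb_or ynz eq_sym xny.
Qed.

End Forests.

(** Every nonzero [d p] is [sigma j] or [- sigma j] for exactly one [j]. Since [F] only sees
    squares, both signs contribute alike, and the symmetry of the fibers yields the factor 2. *)
Lemma sum_of_squares_points (C : numClosedFieldType) (I : finType) (u : C)
    (d : I -> C) s (sigma : 'I_s -> C) (F : C -> C) :
    injective (fun j => sigma j ^+ 2) -> (forall j, sigma j != 0) ->
    (forall p, d p != 0 -> exists j, d p ^+ 2 = sigma j ^+ 2) ->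
    (forall x, \sum_(p | d p == - x) u = \sum_(p | d p == x) u) ->
  \sum_p u * F (d p ^+ 2) =
  (\sum_(p | d p == 0) u) * F 0 +
    \sum_j 2 * (\sum_(p | d p == sigma j) u) * F (sigma j ^+ 2).
Proof.
(* Writing fiber sums with indicators lets the identity be checked for each [p] separately. *)
move=> injs s0 dsig evd; pose w x p : C := (d p == x)%:R * u.
have wE x : \sum_(p | d p == x) u = \sum_p w x p.
  rewrite big_mkcond; apply: eq_bigr => p _.
  by rewrite /w; case: eqP; rewrite ?mul1r ?mul0r.
have -> : \sum_j 2 * (\sum_(p | d p == sigma j) u) * F (sigma j ^+ 2) =
          \sum_p \sum_j (w (sigma j) p + w (- sigma j) p) * F (sigma j ^+ 2).
  rewrite exchange_big; apply: eq_bigr => j _ /=.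
  by rewrite -mulr_suml big_split /= -!wE evd mulr2n mulrDl mul1r.
rewrite wE mulr_suml -big_split; apply: eq_bigr => p _ /=.
case: (eqVneq (d p) 0) => [dp0|/[dup] dp0 /dsig[j dj]].
  rewrite big1 => [|j _]; rewrite /w dp0 ?eqxx ?mul1r ?addr0 ?expr0n //.
  by rewrite eq_sym (negbTE (s0 j)) eq_sym oppr_eq0 (negbTE (s0 j)) !mul0r addr0 mul0r.
rewrite {1}/w (negbTE dp0) !mul0r add0r (bigD1 j) //= big1 => [|i ij].
  have := eqf_sqr (d p) (sigma j); rewrite dj eqxx addr0 => /esym ds.
  rewrite /w; congr (_ * _); rewrite -mulrDl -[LHS]mul1r; congr (_ * _).
  case/orP: ds => /eqP ->; rewrite eqxx ?eqr_oppLR -addr_eq0 -mulr2n mulrn_eq0.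
    by rewrite (negbTE (s0 j)) addr0.
  by rewrite (negbTE (s0 j)) add0r.
have := eqf_sqr (d p) (sigma i); rewrite dj (inj_eq injs).
rewrite eq_sym (negbTE ij) => /esym/negbT; rewrite negb_or => /andP[di dNi].
by rewrite /w (negbTE di) (negbTE dNi) !mul0r addr0 mul0r.
Qed.

(** * Spectra of the signed adjacency matrices *)

Section Spectra.
Variables (C : numClosedFieldType) (T : finType) (G : graph T).
Implicit Type pi : signing G.

Lemma big_fmulE (I : finType) (F : I -> formal_product C) x :
  (\big[@fmul C/fone]_i F i) x = \sum_i F i x.
Proof. exact: (big_morph (fun f : formal_product C => f x)). Qed.

Definition switch_signs pi : signing G := [ffun b => ~~ pi b].

Lemma switch_signsK : involutive switch_signs.
Proof. by move=> pi; apply/ffunP => b; rewrite !ffunE negbK. Qed.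

Lemma signed_adjmxE pi i j :
  signed_adjmx C pi i j = edge_sign C pi [set enum_val i; enum_val j].
Proof. by rewrite mxE. Qed.

Lemma signed_adjmx_switch pi :
  signed_adjmx C (switch_signs pi) = - signed_adjmx C pi.
Proof.
apply/matrixP => i j; rewrite [RHS]mxE !signed_adjmxE.
case: (boolP ([set enum_val i; enum_val j] \in eset G)) => [aG|aG].
  rewrite -[ [set _; _] ]/(val (exist (fun a => a \in eset G) _ aG)).
  by rewrite !edge_sign_val ffunE signrN.
by rewrite !edge_sign_out // oppr0.
Qed.

Lemma signed_adjmx_sym pi : signed_adjmx C pi \is symmetricmx.
Proof.
apply/is_hermitianmxP; rewrite expr0 scale1r map_mx_id //.
by apply/matrixP => i j; rewrite [RHS]mxE !signed_adjmxE setUC.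
Qed.

Lemma signed_adjmx_real pi : signed_adjmx C pi \is a mxOver Num.real.
Proof.
apply/mxOverP => i j; rewrite mxE; case: insub => [b|] /=; last exact: real0.
by rewrite rpredX // rpredN real1.
Qed.

Definition plus_signing : signing G := [ffun=> false].

Lemma adjmx_plus_signing : adjmx C G = signed_adjmx C plus_signing.
Proof.
apply/matrixP => i j; rewrite !mxE.
by case: insubP => [b -> _|/negbTE-> //] /=; rewrite ffunE expr0.
Qed.

Lemma card_signing : #|signing G| = (2 ^ #|eset G|)%N.
Proof. by rewrite card_ffun card_bool card_sig; congr (_ ^ _)%N; apply: eq_card. Qed.

Lemma signings_spectrum : exists d : signing G * 'I_#|vset G| -> C,
  [/\ forall pi x, mup x (char_poly (signed_adjmx C pi)) =
                   #|[set i | d (pi, i) == x]|,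
      forall pi x, mup x (char_poly (signed_adjmx C (switch_signs pi))) =
                   #|[set i | d (pi, i) == - x]|
    & forall pi k, \tr (signed_adjmx C pi ^+ k) = \sum_i d (pi, i) ^+ k].
Proof.
have [d dP] := fin_all_exists (fun pi => real_symmetric_spectrum
  (signed_adjmx_sym pi) (signed_adjmx_real pi)).
exists (fun p => d p.1 p.2); split=> pi; case: (dP pi) => //= d1 d2 d3 x.
by rewrite signed_adjmx_switch d2.
Qed.

End Spectra.

(** * Invertibility of the linear system, and multiplicities of the factors *)

Section VandermondeSystem.
Variables (C : numClosedFieldType) (s : nat) (sigma : 'I_s -> C).

(** Exponents start at 2 rather than 0, so the matrix is a Vandermonde matrix in the distinct
    squares times the diagonal matrix of these nonzero squares. *)
Lemma Mmx_unit :
    injective (fun j => sigma j ^+ 2) -> (forall j, sigma j != 0) ->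
  Mmx sigma \in unitmx.
Proof.
move=> injs s0; pose a : 'rV[C]_s := \row_j sigma j ^+ 2.
have -> : Mmx sigma = Vandermonde s a *m diag_mx a.
  apply/matrixP => l i; rewrite mul_mx_diag !mxE.
  by rewrite -exprM -exprD -mulnSr.
rewrite unitmxE det_mulmx det_Vandermonde det_diag unitfE mulf_neq0 //.
  apply/prodf_neq0 => i _; apply/prodf_neq0 => j ij; rewrite !mxE subr_eq0.
  by rewrite (inj_eq injs) neq_ltn orbC ij.
by apply/prodf_neq0 => i _; rewrite mxE expf_neq0.
Qed.

Lemma mup_X x : mup x ('X : {poly C}) = (x == 0) :> nat.
Proof.
have := mu_prod_XsubC x [:: 0]; rewrite big_seq1 subr0 => -> /=.
by rewrite addn0 eq_sym.
Qed.

Lemma mup_X2subC x c :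
  mup x ('X^2 - (c ^+ 2)%:P : {poly C}) = ((x == c) + (x == - c))%N.
Proof.
have := mu_prod_XsubC x [:: c; - c]; rewrite big_cons big_seq1 /= addn0.
rewrite ![_ == x]eq_sym => <-; congr mup.
by rewrite polyCN opprK -subr_sqr rmorphXn.
Qed.

End VandermondeSystem.

(** * Averaged multiplicities and the two claims *)

Section Averages.
Variables (C : numClosedFieldType) (T : finType) (G : graph T).
Hypothesis sG : simple_graph G.

(** The geometric mean and the characteristic polynomial of [G] become two weightings of the same
    points [d p]: uniform weight [u], and the indicator of the all-plus signing. Their power sums
    count the even closed walks and all closed walks. *)
Lemma average_spectrum : exists d : signing G * 'I_#|vset G| -> C,
  let u : C := 2 ^- #|eset G| in
  [/\ forall x, signed_geometric_mean C G x = \sum_(p | d p == x) u,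
      forall x, \sum_(p | d p == - x) u = \sum_(p | d p == x) u
    & forall x, fpoly (char_poly (adjmx C G)) x =
                \sum_(p | d p == x) (p.1 == plus_signing G)%:R] /\
  [/\ forall p, eigenvalue (signed_adjmx C p.1) (d p),
      forall k, \sum_p u * d p ^+ k =
                #|[set w : T * k.-tuple T | even_closed_walk G w]|%:R
    & forall k, \sum_p (p.1 == plus_signing G)%:R * d p ^+ k =
                #|[set w : T * k.-tuple T | closed_walk G w]|%:R].
Proof.
have [d [d_mup d_mupN d_tr]] := signings_spectrum C G.
set u : C := 2 ^- _.
have pairE (f : signing G * 'I_#|vset G| -> C) :
    \sum_p f p = \sum_pi \sum_i f (pi, i).
  by rewrite pair_bigA; apply: eq_bigr => -[].
have mupE (F : signing G -> 'I_#|vset G| -> bool) :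
    \sum_pi u * #|[set i | F pi i]|%:R = \sum_(p | F p.1 p.2) u.
  rewrite [RHS]big_mkcond pairE /=.
  apply: eq_bigr => pi _; rewrite -big_mkcond /= sumr_const cardsE.
  by rewrite mulr_natr.
have gmE x : signed_geometric_mean C G x = \sum_(p | d p == x) u.
  rewrite /signed_geometric_mean big_fmulE.
  under eq_bigr => pi _ do rewrite /fpow /fpoly d_mup.
  by rewrite mupE; apply: eq_bigl => -[].
have u_unit : 2 ^+ #|eset G| != 0 :> C by rewrite expf_neq0 // pnatr_eq0.
exists d; split; split=> //.
- move=> x; rewrite -gmE /signed_geometric_mean big_fmulE.
  (* Switching all signs permutes the signings and negates their eigenvalues. *)
  rewrite (reindex_inj (inv_inj (@switch_signsK _ G))) /=.
  under eq_bigr => pi _ do rewrite /fpow /fpoly d_mupN opprK.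
  by rewrite mupE; apply: eq_bigl => -[].
- move=> x; rewrite /fpoly adjmx_plus_signing d_mup [RHS]big_mkcond pairE /=.
  rewrite (bigD1 (plus_signing G)) //= [X in _ + X]big1 ?addr0 => [|pi /negbTE pi0].
    by rewrite -big_mkcond eqxx /= sumr_const cardsE.
  by apply: big1 => i _; rewrite pi0 if_same.
- move=> [pi i]; rewrite eigenvalue_root_char -dvdp_XsubCl.
  rewrite XsubC_dvd ?monic_neq0 ?char_poly_monic // d_mup.
  by rewrite card_gt0; apply/set0Pn; exists i; rewrite inE.
- move=> k; rewrite -mulr_sumr pairE.
  under eq_bigr => pi _ do rewrite -d_tr.
  by rewrite sum_signed_adjmx_trace // mulKf.
move=> k; rewrite -adjmx_trace // adjmx_plus_signing d_tr pairE /=.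
rewrite (bigD1 (plus_signing G)) //= [X in _ + X]big1 ?addr0 => [|pi /negbTE pi0].
  by apply: eq_bigr => i _; rewrite eqxx mul1r.
by apply: big1 => i _; rewrite pi0 mul0r.
Qed.

Lemma pseudo_char_geometric_mean s (sigma : 'I_s -> C) chi
    (Ghat : 'I_chi -> graph T) :
    enumerates_sq_eigenvalues G sigma -> isomorphism_representatives G s Ghat ->
  pseudo_char G sigma Ghat =1 signed_geometric_mean C G.
Proof.
move=> [injs sqE] Greps.
have [d [[gmE gmN _] [d_eig d_pow _]]] := average_spectrum.
set u := 2 ^- _ in gmE gmN d_pow; pose gm x := \sum_(p | d p == x) u.
have s0 j : sigma j != 0.
  have [|K [pi [z [_ _ z0 sz]]]] := (sqE (sigma j ^+ 2)).1; first by exists j.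
  by apply: contraNneq z0 => sj0; rewrite -sqrf_eq0 -sz sj0 expr0n.
(* [G] is one of its own subgraphs, so the squares of its signed eigenvalues are among those
   enumerated. *)
have dsig p : d p != 0 -> exists j, d p ^+ 2 = sigma j ^+ 2.
  move=> dp0; apply/sqE; exists G, p.1, (d p); split=> //.
  by rewrite /subgraph sG !subxx.
have Msum := sum_of_squares_points _ injs s0 dsig gmN.
(* The factor 2 accounts for [sigma j] and [- sigma j] together, and cancels the one half in
   [mu]. *)
pose v : 'cV[C]_s := \col_j (2 * gm (sigma j)).
have muE j : mu G sigma Ghat j = gm (sigma j).
  suff PN : Pmx C s Ghat *m Nvec C G Ghat = Mmx sigma *m v.
    by rewrite /mu -mulmxA PN mulKmx ?Mmx_unit // mxE mulKf // pnatr_eq0.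
  apply/colP => l; rewrite !mxE.
  (* Row [l] is the power sum of exponent [2 * l.+1]; the exponent is positive, so the eigenvalue 0
     drops out. *)
  have := Msum (fun y => y ^+ l.+1); rewrite expr0n mulr0 add0r.
  under eq_bigr => p _ do rewrite -exprM.
  rewrite d_pow (card_even_closed_walks sG (_ : _ <= 2 * s)%N); last first.
    by rewrite leq_mul2l ltn_ord orbT.
  rewrite (sum_isomorphism_representatives _ Greps) natr_sum => PN.
  transitivity (\sum_j 2 * gm (sigma j) * (sigma j ^+ 2) ^+ l.+1).
    by rewrite -PN; apply: eq_bigr => i _; rewrite !mxE natrM mulrC.
  by apply: eq_bigr => i _; rewrite !mxE exprM mulrC.
have mu0E : mu0 G sigma Ghat = gm 0.
  (* With [F] constant, the identity says that the averaged multiplicities add up to the number of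
     vertices. *)
  have /= := Msum (fun=> 1); rewrite !mulr1.
  under [X in _ = _ + X]eq_bigr => j _ do rewrite mulr1.
  rewrite sumr_const card_prod card_ord card_signing mulrnA.
  rewrite -[u *+ _]mulr_natr natrX mulVf ?expf_neq0 ?pnatr_eq0 // => sum1.
  by rewrite /mu0 (eq_bigr _ (fun j _ => muE j)) sum1 -mulr_sumr addrK.
move=> x; rewrite gmE -/(gm x) /pseudo_char /fmul big_fmulE /fpow /fpoly.
rewrite mup_X mu0E.
under eq_bigr => j _ do rewrite mup_X2subC muE.
case: (eqVneq x 0) => [->|x0] /=.
  rewrite mulr1 big1 ?addr0 // => j _.
  by rewrite eq_sym (negbTE (s0 j)) eq_sym oppr_eq0 (negbTE (s0 j)) mulr0.
rewrite mulr0 add0r.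
(* Either [x] is [sigma j] or [- sigma j] for a single [j], whose factor alone contributes, or [x]
   is no eigenvalue of any signing and both exponents are 0. *)
have [/existsP[j /eqP xj]|] := boolP [exists j, x ^+ 2 == sigma j ^+ 2].
  rewrite (bigD1 j) //= big1 ?addr0 => [|i ij].
    have := eqf_sqr x (sigma j); rewrite xj eqxx => /esym/orP[] /eqP->.
      by rewrite eqxx -addr_eq0 -mulr2n mulrn_eq0 (negbTE (s0 j)) mulr1.
    rewrite eqxx eq_sym -addr_eq0 -mulr2n mulrn_eq0 (negbTE (s0 j)) mulr1.
    by rewrite /gm gmN.
  have := eqf_sqr x (sigma i); rewrite xj (inj_eq injs) eq_sym (negbTE ij).
  by move=> /esym/negbT; rewrite negb_or => /andP[/negbTE-> /negbTE->]; rewrite mulr0.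
rewrite negb_exists => /forallP nx.
rewrite big1 => [|j _]; last first.
  have := nx j; rewrite eqf_sqr negb_or => /andP[/negbTE-> /negbTE->].
  by rewrite mulr0.
rewrite /gm big_pred0 // => p; apply/negP => /eqP dx.
have [j] : exists j, d p ^+ 2 = sigma j ^+ 2 by apply: dsig; rewrite dx.
by rewrite dx => /eqP; rewrite (negbTE (nx j)).
Qed.

(** The difference [w] of the two weights has zero fiber sums exactly when all its power sums
    vanish, that is, when even closed walks are as numerous as closed walks in every length. *)
Lemma geometric_mean_forest :
  signed_geometric_mean C G =1 fpoly (char_poly (adjmx C G)) <-> forest G.
Proof.
have [d [[gmE _ phiE] [_ d_even d_all]]] := average_spectrum.
set u := 2 ^- _ in gmE d_even.
pose w (p : signing G * 'I_#|vset G|) : C := u - (p.1 == plus_signing G)%:R.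
have w_fiber x : \sum_(p | d p == x) w p =
    signed_geometric_mean C G x - fpoly (char_poly (adjmx C G)) x.
  by rewrite sumrB gmE phiE.
have w_pow k : \sum_p w p * d p ^+ k =
    #|[set w : T * k.-tuple T | even_closed_walk G w]|%:R -
    #|[set w : T * k.-tuple T | closed_walk G w]|%:R.
  rewrite -d_even -d_all -sumrB; apply: eq_bigr => p _.
  by rewrite -mulrBl.
have sub k : [set w : T * k.-tuple T | even_closed_walk G w]
    \subset [set w : T * k.-tuple T | closed_walk G w].
  by apply/subsetP => v; rewrite !inE => /andP[].
split=> [gm_phi|fG x]; last first.
  apply/eqP; rewrite -subr_eq0 -w_fiber; apply/eqP; apply: power_sums_eq0 => k.
  rewrite w_pow; apply/eqP; rewrite subr_eq0 eqr_nat; apply/eqP/eq_card => v.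
  rewrite !inE /even_closed_walk andb_idr // => /and3P[vG vE /eqP vl].
  exact: forest_even_closed_path fG vE vl.
apply: even_closed_path_forest => // x p xG xp lp.
have : #|[set w : T * (size p).-tuple T | closed_walk G w]| =
       #|[set w : T * (size p).-tuple T | even_closed_walk G w]|.
  apply/esym/eqP; rewrite -(eqr_nat C) -subr_eq0 -w_pow; apply/eqP.
  by apply: vanishing_fibers_power_sums => y; rewrite w_fiber gm_phi subrr.
(* Equal cardinality together with inclusion forces every closed walk of this length to be even. *)
move=> card_eq; have /eqP eq_sets : [set w | even_closed_walk G w]
    == [set w : T * (size p).-tuple T | closed_walk G w].
  by rewrite eqEcard sub card_eq leqnn.
have : (x, in_tuple p) \in [set w | closed_walk G w].
  by rewrite inE /closed_walk xG xp /= lp eqxx.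
by rewrite -eq_sets inE => /andP[].
Qed.

End Averages.

Theorem theorem6p1 (C : numClosedFieldType) (T : finType) (G : graph T)
    (s : nat) (sigma : 'I_s -> C) (chi : nat) (Ghat : 'I_chi -> graph T) :
  simple_graph G ->
  enumerates_sq_eigenvalues G sigma ->
  isomorphism_representatives G s Ghat ->
  (pseudo_char G sigma Ghat =1 signed_geometric_mean C G) /\
  (pseudo_char G sigma Ghat =1 fpoly (char_poly (adjmx C G)) <-> forest G).
Proof.
move=> sG sqE Greps; have pcE := pseudo_char_geometric_mean sG sqE Greps.
split=> //; rewrite -(geometric_mean_forest C sG).
by split=> eq_phi x; [rewrite -pcE | rewrite pcE].
Qed.
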